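(* Let $R$ be a nonzero ring and $G$ a group. Suppose that the group ring $RG$ is a $W\sqrt{J}U$ ring and that $2\in J(R)$. Then $G$ is a $2$-group.
   Context: Rings are associative with identity, not necessarily commutative. For a ring $A$, $U(A)$ is its group of units, $J(A)$ its Jacobson radical, and $\sqrt{J(A)}=\{x\in A : x^n\in J(A)\text{ for some } n\ge 1\}$. A ring $A$ is $W\sqrt{J}U$ (weakly $\sqrt{J}U$) if $U(A)=\pm 1+\sqrt{J(A)}$; equivalently, every unit of $A$ can be written as $j+1$ or as $j-1$ for some $j\in\sqrt{J(A)}$. A $2$-group is a (possibly infinite) group in which every element has order a power of $2$. The integer $2$ is regarded as the element $2\cdot 1_R$ of $R$. *)

(* Defs.v *)
From HB Require Import structures.
From mathcomp Require Import all_boot all_algebra finmap.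
From mathcomp Require Import boolp classical_sets.
From mathcomp Require Import monalg.

Set Implicit Arguments.
Unset Strict Implicit.
Unset Printing Implicit Defensive.

Import GRing.Theory.

Local Open Scope classical_set_scope.
Local Open Scope ring_scope.

Section RingNotions.
Variable A : pzRingType.

Definition units : set A := [set u | exists v, u * v = 1 /\ v * u = 1].

Definition left_ideal (I : set A) : Prop :=
  [/\ I 0, forall x y, I x -> I y -> I (x + y) & forall a x, I x -> I (a * x)].

Definition maximal_left_ideal (M : set A) : Prop :=
  [/\ left_ideal M, M != setT &
      forall I, left_ideal I -> M `<=` I -> I = M \/ I = setT].

Definition jacobson : set A :=
  [set x | forall M, maximal_left_ideal M -> M x].

Definition sqrt_jacobson : set A :=
  [set x | exists2 n, (1 <= n)%N & jacobson (x ^+ n)].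

Definition WsqrtJU : Prop :=
  units = [set 1 + j | j in sqrt_jacobson] `|`
          [set - 1 + j | j in sqrt_jacobson].

End RingNotions.

Section TwoGroups.
Variable G : groupType.

Definition has_order (g : G) (n : nat) : Prop :=
  [/\ (0 < n)%N, (g ^+ n = 1)%g &
      forall m, (0 < m < n)%N -> (g ^+ m <> 1)%g].

Definition two_group : Prop := forall g : G, exists k, has_order g (2 ^ k).

End TwoGroups.

(* Finitely supported functions G -> R with the convolution product. Only the
   additive structure of malg is inherited: the library's product on malg
   requires monomials without nontrivial invertible elements. *)
Definition groupring (R : nzRingType) (G : groupType) : Type := {malg R[G]}.

HB.instance Definition _ (R : nzRingType) (G : groupType) :=
  GRing.Zmodule.copy (groupring R G) {malg R[G]}.

Section GroupRing.
Variables (R : nzRingType) (G : groupType).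
Implicit Types (x y z : groupring R G).

Definition grone : groupring R G := << 1 *g 1%g >>.

Definition grmul x y : groupring R G :=
  \sum_(h <- msupp x) \sum_(k <- msupp y) << x@_h * y@_k *g (h * k)%g >>.

Lemma grmulw (d1 d2 : {fset G}) x y :
  (msupp x `<=` d1)%fset -> (msupp y `<=` d2)%fset ->
  grmul x y =
    \sum_(h <- d1) \sum_(k <- d2) << x@_h * y@_k *g (h * k)%g >>.
Proof.
move=> le_d1 le_d2; rewrite /grmul (big_fset_incl _ le_d1) /=.
  apply/eq_bigr=> h _; apply/big_fset_incl => // k _ /mcoeff_outdom ->.
  by rewrite mulr0 monalgU0.
move=> h _ /mcoeff_outdom xh.
by rewrite big1 // => k _; rewrite xh mul0r monalgU0.
Qed.

Lemma grmul0r : left_zero 0 grmul.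
Proof. by move=> x; rewrite /grmul msupp0 big_seq_fset0. Qed.

Lemma grmulr0 : right_zero 0 grmul.
Proof.
by move=> x; rewrite /grmul big1 // => h _; rewrite msupp0 big_seq_fset0.
Qed.

Lemma grmulUg c h x :
  grmul << c *g h >> x = \sum_(k <- msupp x) << c * x@_k *g (h * k)%g >>.
Proof.
rewrite (grmulw msuppU_le (fsubset_refl _)) big_seq_fset1.
by apply/eq_bigr => k _; rewrite mcoeffUU.
Qed.

Lemma grmulgU c k x :
  grmul x << c *g k >> = \sum_(h <- msupp x) << x@_h * c *g (h * k)%g >>.
Proof.
rewrite (grmulw (fsubset_refl _) msuppU_le).
by apply/eq_bigr=> h _; rewrite big_seq_fset1 mcoeffUU.
Qed.

Lemma grmulUU a b h k :
  grmul << a *g h >> << b *g k >> = << a * b *g (h * k)%g >>.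
Proof. by rewrite (grmulw msuppU_le msuppU_le) !big_seq_fset1 !mcoeffUU. Qed.

Lemma grmulEl x y : grmul x y = \sum_(h <- msupp x) grmul << x@_h *g h >> y.
Proof. by apply/eq_bigr=> h _; rewrite grmulUg. Qed.

Lemma grmulEr x y : grmul x y = \sum_(k <- msupp y) grmul x << y@_k *g k >>.
Proof.
by rewrite [LHS]/grmul exchange_big; apply/eq_bigr=> k _; rewrite grmulgU.
Qed.

Lemma grmul1r : left_id grone grmul.
Proof.
move=> x; rewrite grmulUg [RHS]monalgE.
by apply/eq_bigr=> k _; rewrite mul1r mul1g.
Qed.

Lemma grmulr1 : right_id grone grmul.
Proof.
move=> x; rewrite grmulgU [RHS]monalgE.
by apply/eq_bigr=> k _; rewrite mulr1 mulg1.
Qed.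

Lemma grmulDl : left_distributive grmul +%R.
Proof.
move=> x y z.
rewrite (grmulw (msuppD_le x y) (fsubset_refl _)).
rewrite (grmulw (fsubsetUl _ (msupp y)) (fsubset_refl (msupp z))).
rewrite (grmulw (fsubsetUr (msupp x) _) (fsubset_refl (msupp z))).
rewrite -big_split /=; apply/eq_bigr=> h _.
rewrite -big_split /=; apply/eq_bigr=> k _.
by rewrite mcoeffD mulrDl monalgUD.
Qed.

Lemma grmulDr : right_distributive grmul +%R.
Proof.
move=> z x y.
rewrite (grmulw (fsubset_refl _) (msuppD_le x y)).
rewrite (grmulw (fsubset_refl (msupp z)) (fsubsetUl _ (msupp y))).
rewrite (grmulw (fsubset_refl (msupp z)) (fsubsetUr (msupp x) _)).
rewrite -big_split /=; apply/eq_bigr=> h _.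
rewrite -big_split /=; apply/eq_bigr=> k _.
by rewrite mcoeffD mulrDr monalgUD.
Qed.

Lemma grmulA : associative grmul.
Proof.
move=> x y z.
rewrite [RHS](big_morph (grmul^~ _) (fun _ _ => grmulDl _ _ _) (grmul0r _)).
rewrite grmulEl; apply/eq_bigr=> h _.
rewrite [LHS](big_morph (grmul _) (fun _ _ => grmulDr _ _ _) (grmulr0 _)).
rewrite [RHS](big_morph (grmul^~ _) (fun _ _ => grmulDl _ _ _) (grmul0r _)).
apply/eq_bigr=> k _.
rewrite [LHS](big_morph (grmul _) (fun _ _ => grmulDr _ _ _) (grmulr0 _)).
by rewrite grmulEr; apply/eq_bigr=> l _; rewrite !grmulUU mulrA mulgA.
Qed.

Lemma grone_neq0 : grone != 0.
Proof. by rewrite monalgU_eq0 oner_eq0. Qed.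

HB.instance Definition _ := GRing.Zmodule_isNzRing.Build (groupring R G)
  grmulA grmul1r grmulr1 grmulDl grmulDr grone_neq0.

End GroupRing.

(* Main.v *)
Require Import Defs.
From mathcomp Require Import all_boot all_algebra finmap.
From mathcomp Require Import boolp classical_sets.
From mathcomp Require Import monalg.

(** A group element g is a unit of RG, hence g = 1 + j or g = -1 + j with j
    nilpotent modulo J(RG). So one of g - 1, g + 1 lies in sqrt J(RG), and then
    so does their product g^2 - 1. Passing to squares thus removes the sign:
    every h = g^2 satisfies (h - 1)^n in J(RG) for some n. Two facts about such
    an h give the result.

    First, h has finite order. Otherwise 1 + h (h - 1)^n would have a left
    inverse u (an element of the form 1 - a y with y in J(RG) always has one).
    In a coset x<h> that it meets, and that is ordered like the integers, the
    support of u has a last and a first point. Since 1 + h (h - 1)^n is a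
    polynomial in h with constant and leading coefficients 1, right
    multiplication by it keeps the coefficient at the first point and moves
    the coefficient at the last point n + 1 steps up; so the product is
    supported on at least two points and is not 1
    ([infinite_order_no_left_inverse]).

    Second, if h^m = 1 with m odd, then h = 1. Indeed m is invertible in R
    because 2 lies in J(R), and summing the h^i - 1 shows that
    h - 1 = c (h - 1)^2 for some c ([root_of_unity_regular]). Iterating,
    h - 1 = c^n (h - 1)^n (h - 1) with c^n (h - 1)^n in J(RG), so h - 1 = 0
    ([regular_sqrt_jacobson_eq0]).

    By the first fact g^2, hence g, has finite order; let 2^k m' be a period of
    g^2 with m' odd. The second fact applies to the square of g^(2^k), whose
    m'-th power is 1, and gives g^(2^(k+1)) = 1. *)

Import GRing.Theory.

Local Open Scope ring_scope.

(** * The Jacobson radical *)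

Section Jacobson.
Variable A : pzRingType.
Implicit Types a x y : A.

Lemma jacobson_mull a {x} : jacobson x -> jacobson (a * x).
Proof.
by move=> Jx M maxM; have [[_ _ IM] _ _] := maxM; apply: IM; apply: Jx.
Qed.

Lemma left_ideal_bigcup (F : set (set A)) :
    (F !=set0)%classic -> (forall I, F I -> left_ideal I) -> total_on F subset ->
  left_ideal (\bigcup_(I in F) I)%classic.
Proof.
move=> [I0 FI0] idF totF; split.
- by exists I0 => //; have [] := idF _ FI0.
- move=> x y [I FI Ix] [K FK Ky].
  have [IK|KI] := totF _ _ FI FK.
    by exists K => //; have [_ + _] := idF _ FK; apply => //; apply: IK.
  by exists I => //; have [_ + _] := idF _ FI; apply => //; apply: KI.
- by move=> a x [I FI Ix]; exists I => //; have [_ _ +] := idF _ FI; apply.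
Qed.

Lemma left_ideal1 (I : set A) : left_ideal I -> I 1 -> I = setT.
Proof.
move=> [_ _ IM] I1; apply/seteqP; split=> // x _.
by rewrite -[x]mulr1; apply: IM.
Qed.

Lemma proper_left_ideal_sub_maximal (I : set A) :
    left_ideal I -> ~ I 1 ->
  exists2 M, maximal_left_ideal M & (I `<=` M)%classic.
Proof.
move=> idI I1.
(* The empty set is admitted so that the empty chain has its union in P. *)
pose P (K : set A) := K = set0 \/ [/\ left_ideal K, ~ K 1 & (I `<=` K)%classic].
have [|M [PM maxM]] := @Zorn_bigcup A P.
  move=> F FP totF; pose F' := (F `&` [set K | K !=set0])%classic.
  have ->: (\bigcup_(K in F) K = \bigcup_(K in F') K)%classic.
    apply/seteqP; split=> x [K FK Kx]; exists K => //; last by case: FK.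
    by split=> //; exists x.
  have F'P K : F' K -> [/\ left_ideal K, ~ K 1 & (I `<=` K)%classic].
    by move=> [/FP[->|//] [x]].
  have [[K F'K]|F'0] := pselect (F' !=set0)%classic; last first.
    left; apply/seteqP; split=> // x [K F'K _].
    by apply: F'0; exists K.
  right; split.
  - apply: left_ideal_bigcup; first by exists K.
      by move=> L /F'P[].
    by move=> L N [FL _] [FN _]; apply: totF.
  - by move=> [L /F'P[]].
  - by move=> x Ix; exists K => //; have [_ _ IK] := F'P _ F'K; apply: IK.
have {PM} [idM M1 IM] : [/\ left_ideal M, ~ M 1 & (I `<=` M)%classic].
  case: PM => // M0; case: (maxM I); last by right; split.
  have [I0 _ _] := idI; rewrite M0; split=> //.
  by move=> /(_ _ I0).
exists M => //; split=> //.
  by apply/eqP=> MT; apply: M1; rewrite MT.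
move=> K idK MK; have [KM|nKM] := pselect (K `<=` M)%classic.
  by left; apply/seteqP.
right; have [K1|K1] := pselect (K 1); first exact: left_ideal1.
by case: (maxM K) => //; right; split=> //; apply: subset_trans MK.
Qed.

(** Otherwise the left ideal generated by [1 - x] would be proper, hence inside
    a maximal one; the latter also contains [x], so it would contain 1. *)
Lemma jacobson_left_inverse {x} : jacobson x -> exists u, u * (1 - x) = 1.
Proof.
move=> Jx; apply: contrapT => noinv.
pose I := [set y | exists u, y = u * (1 - x)]%classic.
have idI : left_ideal I.
  split.
  - by exists 0; rewrite mul0r.
  - by move=> _ _ [u ->] [v ->]; exists (u + v); rewrite mulrDl.
  - by move=> a _ [u ->]; exists (a * u); rewrite mulrA.
have [|M maxM IM] := proper_left_ideal_sub_maximal I idI.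
  by move=> [u ?]; apply: noinv; exists u.
have [idM /eqP MT _] := maxM; apply: MT; apply: left_ideal1 => //.
have [_ MD _] := idM; rewrite -[1](subrK x).
by apply: MD; [apply: IM; exists 1; rewrite mul1r | apply: Jx].
Qed.

(** Iterating the hypothesis gives [x = c ^+ n * x ^+ n * x] for every [n]; when
    [x ^+ n] is in the radical, [1 - c ^+ n * x ^+ n] is left invertible and
    kills [x]. *)
Lemma regular_sqrt_jacobson_eq0 {x c} :
  x = c * x ^+ 2 -> sqrt_jacobson x -> x = 0.
Proof.
move=> xc [n _ Jxn].
have xE : x = c ^+ n * x ^+ n * x.
  elim: n {Jxn} => [|n IHn]; first by rewrite !mulr1 mul1r.
  rewrite -mulrA -exprSr [c ^+ n.+1]exprSr -mulrA exprS.
  have -> : c * (x * x ^+ n.+1) = x ^+ n * x.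
    by rewrite exprS !mulrA -[c * x * x]mulrA -expr2 -xc -exprS exprSr.
  by rewrite mulrA.
have [u uV] := jacobson_left_inverse (jacobson_mull (c ^+ n) Jxn).
by rewrite -[x]mul1r -uV -mulrA mulrBl mul1r -xE subrr mulr0.
Qed.

(** An odd [m] is [1 - (- m./2) * 2], with the multiple of 2 in the radical. *)
Lemma odd_left_inverse {m} : @jacobson A 2%:R -> odd m ->
  exists u : A, u *+ m = 1.
Proof.
move=> J2 m_odd.
have [u uV] := jacobson_left_inverse (jacobson_mull (- m./2%:R) J2).
exists u; rewrite -uV mulNr opprK -natrM nat1r muln2.
by rewrite mulr_natr -[in LHS](odd_double_half m) m_odd.
Qed.

(** Both factors of [x ^+ 2 - 1] are polynomials in [x], so nilpotency modulo
    the radical of either one passes to the product. *)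
Lemma sqrt_jacobson_sqrB1 {x} :
  sqrt_jacobson (x - 1) \/ sqrt_jacobson (x + 1) ->
  sqrt_jacobson (x ^+ 2 - 1).
Proof.
have cx : GRing.comm (x - 1) (x + 1).
  apply: commrD; last exact: commr1.
  by apply/commr_sym/commrB => //; apply: commr1.
move=> [] [n n_gt0 Jn]; exists n => //; rewrite subr_sqr_1.
  by rewrite cx exprMn_comm; [apply: jacobson_mull | apply: commr_sym].
by rewrite exprMn_comm //; apply: jacobson_mull.
Qed.

End Jacobson.

(** Let [b] be the sum over [i < m] of the quotients of [x ^+ i - 1] by [x - 1].
    Then [b * (x - 1)] is the sum of the [x ^+ i] minus [m], and that sum is
    killed by [x - 1]; hence [b * (x - 1) ^+ 2 = - m * (x - 1)], where [m] can be
    cancelled. *)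
Lemma root_of_unity_regular {A : pzRingType} {x u : A} {m} :
  x ^+ m = 1 -> u *+ m = 1 -> exists c, x - 1 = c * (x - 1) ^+ 2.
Proof.
move=> xm um.
have geom i : x ^+ i - 1 = (\sum_(j < i) x ^+ j) * (x - 1).
  rewrite subrX1; apply: commr_sum => j _; apply/commr_sym/commrB.
    exact/commr_sym/commrX.
  exact: commr1.
pose b := \sum_(i < m) \sum_(j < i) x ^+ j.
exists (- (u * b)).
have -> : - (u * b) * (x - 1) ^+ 2 = - (u * (b * (x - 1) * (x - 1))).
  by rewrite mulNr expr2 !mulrA.
have -> : b * (x - 1) = \sum_(i < m) x ^+ i - m%:R.
  rewrite mulr_suml -[m in m%:R]card_ord -sumr_const -sumrB.
  by apply: eq_bigr => i _; rewrite geom.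
rewrite mulrBl -geom xm subrr sub0r mulrN opprK mulrA.
by rewrite mulr_natr um mul1r.
Qed.

(** * Group elements in the group ring *)

Section GroupElements.
Variables (R : nzRingType) (G : groupType).
Implicit Types (g h x : G) (u v : groupring R G).

Definition grelt g : groupring R G := << 1 *g g >>.

Lemma grelt1 : grelt 1%g = 1. Proof. by []. Qed.

Lemma greltM g h : grelt (g * h)%g = grelt g * grelt h.
Proof. by rewrite [RHS]grmulUU mulr1. Qed.

Lemma greltX g n : grelt (g ^+ n)%g = grelt g ^+ n.
Proof. by elim: n => // n IHn; rewrite exprS -IHn -greltM expgS. Qed.

Lemma grelt_inj : injective grelt.
Proof.
move=> g h /malgP/(_ g); rewrite !mcoeffU eqxx.
by case: eqP => // _ /eqP; rewrite oner_eq0.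
Qed.

Lemma units_grelt g : @units (groupring R G) (grelt g).
Proof. by exists (grelt g^-1%g); rewrite -!greltM mulgV mulVg. Qed.

Lemma mcoeff_mulr_grelt v g x : (v * grelt g)@_x = v@_(x * g^-1)%g.
Proof.
rewrite [v * _]grmulgU raddf_sum /=.
rewrite [in RHS](monalgE v) raddf_sum /=; apply: eq_bigr => h _.
rewrite !mcoeffU mulr1; congr (_ *+ _); congr nat_of_bool.
by apply/eqP/eqP => [<-|->]; rewrite ?mulgK ?mulgVK.
Qed.

Lemma mcoeff_mulB1 v g x :
  (v * (grelt g - 1))@_x = v@_(x * g^-1)%g - v@_x.
Proof. by rewrite mulrBr mulr1 mcoeffB mcoeff_mulr_grelt. Qed.

(** If the support of [v] on the coset of [x] stops at [x], multiplying by
    [grelt h - 1] moves this end point one step up with its coefficient, the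
    leading coefficient of [grelt h - 1] being 1. The tail is included, with
    zero coefficients, to let the induction go through. *)
Lemma mcoeff_top v h x :
    (forall j, (0 < j)%N -> v@_(x * h ^+ j)%g = 0) -> forall n j,
  (v * (grelt h - 1) ^+ n)@_(x * h ^+ (n + j))%g = v@_(x * h ^+ j)%g.
Proof.
move=> top_x; elim=> [|n IHn] j; first by rewrite mulr1.
rewrite exprSr mulrA mcoeff_mulB1 addSn -addnS IHn top_x // subr0.
by rewrite addnS expgSr mulgA mulgK IHn.
Qed.

Lemma mcoeff_below v h x :
    (forall j, v@_(x * h^-1 ^+ j)%g = 0) -> forall n j,
  (v * (grelt h - 1) ^+ n)@_(x * h^-1 ^+ j)%g = 0.
Proof.
move=> low_x; elim=> [|n IHn] j; first by rewrite mulr1.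
rewrite exprSr mulrA mcoeff_mulB1 -mulgA -expgSr.
by rewrite !IHn subrr.
Qed.

(** * Elements of infinite order *)

Definition infinite_order h : Prop :=
  forall m, (0 < m)%N -> (h ^+ m)%g <> 1%g.

Lemma infinite_orderV {h} : infinite_order h -> infinite_order h^-1%g.
Proof.
move=> inf m m_gt0; rewrite expVgn => hm; apply: (inf m m_gt0).
by rewrite -[(h ^+ m)%g]invgK hm invg1.
Qed.

(** Each element of [s] is met at most once by the powers of [h]. *)
Lemma infinite_order_bounded {h} : infinite_order h -> forall x (s : seq G),
  exists N, forall i, (x * h ^+ i)%g \in s -> (i <= N)%N.
Proof.
move=> inf x; elim=> [|y s [N IHs]]; first by exists 0%N.
have inj i j : (x * h ^+ i = x * h ^+ j)%g -> (i <= j)%N.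
  move=> /mulgI hij; rewrite leqNgt; apply/negP => lt_ji.
  apply: (inf (i - j)%N); first by rewrite subn_gt0.
  by apply: (@mulgI _ (h ^+ j)%g); rewrite -expgnDr subnKC ?mulg1 // ltnW.
have [[k <-]|noy] := pselect (exists k, (x * h ^+ k)%g = y).
  exists (maxn N k) => i; rewrite inE => /orP[/eqP/inj|/IHs] le_i.
    exact: leq_trans le_i (leq_maxr _ _).
  exact: leq_trans le_i (leq_maxl _ _).
exists N => i; rewrite inE => /orP[/eqP xi|/IHs //].
by case: noy; exists i.
Qed.

Lemma exists_top {h} v {x} : infinite_order h -> v@_x != 0 ->
  exists2 i, v@_(x * h ^+ i)%g != 0 &
    forall j, (0 < j)%N -> v@_(x * h ^+ i * h ^+ j)%g = 0.
Proof.
move=> inf vx; have [N leN] := infinite_order_bounded inf x (msupp v).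
pose P i := v@_(x * h ^+ i)%g != 0.
have exP : exists i, P i by exists 0%N; rewrite /P expg0 mulg1.
have leP i : P i -> (i <= N)%N by move=> Pi; apply: leN; rewrite -mcoeff_neq0.
case: (ex_maxnP exP leP) => i Pi max_i; exists i => // j j_gt0.
apply/eqP; apply: contraLR j_gt0; rewrite -mulgA -expgnDr => /max_i.
by rewrite -leqNgt -[leqRHS]addn0 leq_add2l.
Qed.

(** A left inverse [u] has, on some coset of the cyclic group of [h], a last
    support point [x] and a first one [x * h^-1 ^+ k]. The product is nonzero
    at [x * h ^+ n.+1] and at [x * h^-1 ^+ k], so both these elements would be 1,
    and [h ^+ (k + n.+1)] as well. *)
Lemma infinite_order_no_left_inverse {h} n u : infinite_order h ->
  u * (1 + grelt h * (grelt h - 1) ^+ n) != 1.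
Proof.
move=> inf; apply/eqP; rewrite mulrDr mulr1 mulrA => u1.
set v := u * grelt h in u1.
have vE x : v@_x = u@_(x * h^-1)%g by rewrite mcoeff_mulr_grelt.
have coef1 x : u@_x + (v * (grelt h - 1) ^+ n)@_x = 1 *+ (1%g == x).
  by rewrite -mcoeffD u1 mcoeffU.
(* The coset is chosen through any support point x0 of u. *)
have [x0 ux0] : exists x, u@_x != 0.
  apply: contrapT => u0; suff u_eq0 : u = 0.
    move: u1; rewrite /v u_eq0 !mul0r addr0 => /eqP.
    by rewrite eq_sym oner_eq0.
  apply/malgP => x; rewrite mcoeff0; apply/eqP/negPn/negP => ux.
  by apply: u0; exists x.
have supp1 x : u@_x + (v * (grelt h - 1) ^+ n)@_x != 0 -> x = 1%g.
  by rewrite coef1; case: (1%g =P x) => // _; rewrite mulr0n eqxx.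
have [i ui top_i] := exists_top u inf ux0.
set x := (x0 * h ^+ i)%g in ui top_i.
have xn : (x * h ^+ n.+1 = 1)%g.
  have top_xh j : (0 < j)%N -> v@_(x * h * h ^+ j)%g = 0.
    by move=> j_gt0; rewrite vE -(mulgA x) -expgS expgSr mulgA mulgK top_i.
  apply: supp1; rewrite top_i // add0r expgS mulgA.
  have := mcoeff_top v h _ top_xh n 0; rewrite addn0 => ->.
  by rewrite expg0 mulg1 vE mulgK.
(* The first point is the last one with respect to h^-1. *)
have [k uk low_k] := exists_top u (infinite_orderV inf) ui.
have y1 : (x * h^-1 ^+ k = 1)%g.
  apply: supp1; set y := (x * h^-1 ^+ k)%g in uk low_k *.
  suff -> : (v * (grelt h - 1) ^+ n)@_y = 0 by rewrite addr0.
  rewrite -[y in _@_y]mulg1 -(expg0 h^-1%g).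
  by apply: mcoeff_below => j; rewrite vE -mulgA -expgSr low_k.
apply: (inf (k + n.+1)%N); first by rewrite addnS.
by rewrite expgnDr -[X in _ = X]xn; congr (_ * _)%g;
  rewrite -[x]mulg1 -(mulVg (h ^+ k)%g) mulgA -expVgn y1 mul1g.
Qed.

(** * Orders of group elements *)

Lemma odd_order_sqrt_jacobson {h m} : @jacobson R 2%:R -> odd m ->
    (h ^+ m = 1)%g -> @sqrt_jacobson (groupring R G) (grelt h - 1) ->
  h = 1%g.
Proof.
move=> J2 m_odd hm Jh.
have [q qm] := odd_left_inverse R J2 m_odd.
have qm' : (<< q *g 1%g >> : groupring R G) *+ m = 1.
  by rewrite -[LHS](monalgUMn 1%g m q) qm.
have xm : grelt h ^+ m = 1 by rewrite -greltX hm.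
have [c hc] := root_of_unity_regular xm qm'.
apply: grelt_inj; rewrite grelt1; apply/eqP; rewrite -subr_eq0; apply/eqP.
exact: regular_sqrt_jacobson_eq0 hc Jh.
Qed.

Lemma sqrt_jacobson_finite_order {h} :
  @sqrt_jacobson (groupring R G) (grelt h - 1) ->
  exists2 m, (0 < m)%N & (h ^+ m = 1)%g.
Proof.
move=> [n _ Jn]; apply: contrapT => inf.
have [u] := jacobson_left_inverse _ (jacobson_mull _ (- grelt h) Jn).
rewrite mulNr opprK => /eqP; apply/negP.
by apply: infinite_order_no_left_inverse => m m_gt0 hm; apply: inf; exists m.
Qed.

Lemma WsqrtJU_sqrt_jacobson g : WsqrtJU (groupring R G) ->
  @sqrt_jacobson (groupring R G) (grelt (g ^+ 2)%g - 1).
Proof.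
move=> hRG; rewrite greltX; apply: sqrt_jacobson_sqrB1.
have := units_grelt g; rewrite hRG => -[] [j Jj <-].
  by left; rewrite addrC addrA addNr add0r.
by right; rewrite addrC addrA subrr add0r.
Qed.

End GroupElements.

Lemma has_order_pow2 {G : groupType} {g : G} {k} :
  (g ^+ (2 ^ k) = 1)%g -> exists j, has_order g (2 ^ j).
Proof.
move=> gk; pose P m := (0 < m)%N && (g ^+ m == 1)%g.
have exP : exists m, P m by exists (2 ^ k)%N; rewrite /P expn_gt0 gk eqxx.
case: (ex_minnP exP) => m /andP[m_gt0 /eqP gm] min_m.
have : (m %| 2 ^ k)%N.
  rewrite /dvdn; apply: contraT; rewrite -lt0n => r_gt0.
  have := ltn_pmod (2 ^ k) m_gt0; rewrite ltnNge min_m //.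
  rewrite /P r_gt0; apply/eqP; move: gk.
  by rewrite {1}(divn_eq (2 ^ k) m) expgnDr mulnC expgnA gm expg1n mul1g.
move=> /(dvdn_pfactor m k (isT : prime 2)) [j _ mE]; exists j; rewrite -mE.
split=> // i /andP[i_gt0 i_lt] gi; move: i_lt; rewrite ltnNge min_m //.
by rewrite /P i_gt0 gi eqxx.
Qed.

Theorem lemma3p3 (R : nzRingType) (G : groupType)
  (hRG : WsqrtJU (groupring R G)) (h2 : @jacobson R 2%:R) : two_group G.
Proof.
move=> g; have Jsqr x := WsqrtJU_sqrt_jacobson R G x hRG.
have [m m_gt0 gm] := sqrt_jacobson_finite_order _ _ (Jsqr g).
have [m' m'_odd mE] := pfactor_coprime (isT : prime 2) m_gt0.
rewrite coprime2n in m'_odd.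
set k := logn 2 m in mE.
apply: (@has_order_pow2 _ _ k.+1); rewrite expnSr expgnA.
apply: (odd_order_sqrt_jacobson _ _ h2 m'_odd _ (Jsqr _)).
by rewrite -!expgnA mulnCA [(2 ^ k * m')%N]mulnC -mE expgnA.
Qed.
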